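(* Let $H$ be a simple hypergraph, let $u$ be a vertex of $H$, and let $H_{uv}$ denote the hypergraph obtained from $H$ by adding a new vertex $v$ and joining it with $u$ (i.e. adding the edge $\{u,v\}$). Then $$P_{\mathbf{U}(H_{uv})}(x)=x\,P_{\mathbf{U}(H)}(x)-P_{\mathbf{U}(H)(\{u\}|\{u\})}(x).$$ Furthermore, if $u$ is a $g$-vertex of $H$, then $$P_{\mathbf{U}(H_{uv})}(x)=x\,P_{\mathbf{U}(H)}(x)-P_{\mathbf{U}(H\backslash\{u\})}(x).$$
   Context: A hypergraph $H$ consists of a finite non-empty vertex set $V(H)$ and a multiset $E(H)$ of non-empty subsets of $V(H)$, called edges. It is simple if it has no loops (edges of cardinality one) and no multiple edges. A 2-partition of a set $e$ is an unordered pair $\{S,S'\}$ of non-empty disjoint sets with $S\cup S'=e$; $S$ and $S'$ are called parts of $e$. $I(H)$ is the set of all parts of all edges of $H$ together with all singleton subsets of $V(H)$. For simple $H$, the unified matrix $\mathbf{U}(H)$ is the matrix indexed by $I(H)$ whose $(S,S')$ entry is $1$ if $\{S,S'\}$ is a 2-partition of an edge of $H$, and $0$ otherwise. $\mathbf{U}(H)(\{u\}|\{u\})$ denotes the matrix obtained from $\mathbf{U}(H)$ by deleting the row and the column indexed by the element $\{u\}$ of $I(H)$. $P_M(x)=\det(xI-M)$ is the characteristic polynomial of $M$ (equal to $1$ for the empty matrix). A vertex $v$ of $H$ is a $g$-vertex if $v\notin e$ for every $e\in E(H)$ with $|e|>2$. $H\backslash\{u\}$ is the hypergraph obtained from $H$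 by deleting the vertex $u$ and all edges containing $u$. *)

(* Defs.v *)
From HB Require Import structures.
From mathcomp Require Import all_boot all_order all_algebra.
From mathcomp Require Import finmap multiset.
Set Implicit Arguments.
Unset Strict Implicit.
Unset Printing Implicit Defensive.
Import GRing.Theory.

Local Open Scope mset_scope.

(* The vertices of a hypergraph form a subset of an ambient finite type, so
   that "adding a new vertex" and "deleting a vertex" stay inside that type.
   The well-formedness conditions are kept in [is_hypergraph], because deleting
   the only vertex of a hypergraph yields an empty vertex set. *)
Record hypergraph (T : finType) := Hypergraph {
  vertices : {set T};
  edges : {mset {set T}} }.

Section Hypergraphs.
Variable T : finType.
Implicit Types (H : hypergraph T) (S e : {set T}) (u v : T).

Definition is_hypergraph H : Prop :=
  vertices H != set0 /\
  (forall e, e \in edges H -> e != set0 /\ e \subset vertices H).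

Definition simple_hypergraph H : Prop :=
  [/\ is_hypergraph H,
      (forall e, e \in edges H -> #|e| != 1) &
      (forall e, edges H e <= 1)].

Definition two_partition e S S' : bool :=
  [&& S != set0, S' != set0, [disjoint S & S'] & S :|: S' == e].

Definition part_of e S : bool := [exists S' : {set T}, two_partition e S S'].

Definition index_set H : {set {set T}} :=
  [set S | [exists e in edges H, part_of e S]]
    :|: [set [set x] | x in vertices H].

Definition is_g_vertex H v : Prop :=
  v \in vertices H /\ (forall e, e \in edges H -> 2 < #|e| -> v \notin e).

Definition delete_vertex H u : hypergraph T :=
  Hypergraph (vertices H :\ u)
    [fsfun e in finsupp (edges H) => if u \in e then 0 else edges H e].

(* Meant for [u \in vertices H] and [v \notin vertices H]. *)
Definition add_pendant H u v : hypergraph T :=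
  Hypergraph (v |: vertices H) ([set u; v] +` edges H).

Lemma singleton_in_index_set H u :
  u \in vertices H -> [set u] \in index_set H.
Proof. by move=> uH; rewrite inE imset_f ?orbT. Qed.

Definition singleton_index H u (uH : u \in vertices H) : 'I_#|index_set H| :=
  enum_rank_in (singleton_in_index_set uH) [set u].

Local Open Scope ring_scope.

Definition unified_matrix (R : comNzRingType) H : 'M[R]_#|index_set H| :=
  \matrix_(i, j)
    ([exists e in edges H,
        two_partition e (@enum_val _ (index_set H) i)
                        (@enum_val _ (index_set H) j)])%:R.

End Hypergraphs.

Definition delete_row_col (R : comNzRingType) n (A : 'M[R]_n) (i : 'I_n) :
  'M[R]_n.-1 := row' i (col' i A).

(* Main.v *)
Require Import Defs.
From HB Require Import structures.
From mathcomp Require Import all_boot all_order all_algebra all_fingroup.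
From mathcomp Require Import finmap multiset.
Import GRing.Theory.
Local Open Scope ring_scope.

Set Implicit Arguments.
Unset Strict Implicit.

(** The vertex [v] meets no edge of the extended hypergraph other than
    [{u, v}], so the unified matrix of [H_uv] is that of [H] with one more index
    [{v}], whose row and column are zero except for a one at [{u}]
    ([index_set_add_pendant], [adjacent_pendant], [adjacent_add_pendant]).
    Expanding [det (xI - U)] along that row, and then the cofactor of [{u}]
    along the column of [{v}], gives the first formula; this is the classical
    argument for a pendant vertex of a graph, and works for any matrix of this
    shape ([char_poly_pendant]).

    When [u] is a g-vertex, an edge through [u] is a pair [{u, w}] and its only
    parts are [{u}] and the singleton [{w}], which remains an index once [u] is
    deleted. Hence deleting the vertex [u] amounts to striking out the index
    [{u}] ([index_set_delete_vertex], [adjacent_delete_vertex]), and the second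
    formula follows from the first.

    The enumerations of the index sets of [H], [H_uv] and [H \ u] are unrelated,
    so all the matrices are compared through [relmx], the matrix of a function
    over an explicit list of indices: reordering the indices conjugates by a
    permutation matrix and preserves the characteristic polynomial
    ([char_poly_relmx]). *)

(** * Characteristic polynomials and reindexing *)

(** Pendant-vertex expansion. Row [0] has at most two nonzero entries, at [0]
    and [1]. In the cofactor of the second one, column [0] of [M] survives with
    a single nonzero entry, that of row [1], so a second expansion along it
    leaves the minor with the rows and columns [0] and [1] removed. *)
Lemma det_pendant (R : comPzRingType) n (M : 'M[R]_n.+2) :
    (forall j, M ord0 (lift ord0 (lift ord0 j)) = 0) ->
    (forall i, M (lift ord0 (lift ord0 i)) ord0 = 0) ->
  let M' := row' ord0 (col' ord0 M) in
  \det M = M ord0 ord0 * \det M'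
           - M ord0 (lift ord0 ord0) * M (lift ord0 ord0) ord0
             * \det (row' ord0 (col' ord0 M')).
Proof.
move=> row0 col0 M'; rewrite (expand_det_row _ ord0) 2!big_ord_recl.
rewrite big1 => [|j _]; last by rewrite row0 mul0r.
rewrite addr0 /cofactor expr0 mul1r -[(ord0 + _)%N]/1%N expr1 mulN1r mulrN;
  congr (_ - _).
rewrite -mulrA; congr (_ * _).
rewrite (expand_det_col _ ord0) big_ord_recl.
rewrite big1 => [|i _]; last first.
  rewrite !mxE.
  rewrite [lift (lift _ _) _](_ : _ = ord0) ?col0 ?mul0r //.
  exact: val_inj.
rewrite addr0 /cofactor expr0 mul1r !mxE.
congr (_ * _); first by congr (M _ _); apply: val_inj.
congr (\det _); apply/matrixP=> i j; rewrite !mxE.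
by congr (M _ _); apply: val_inj.
Qed.

Section CharPoly.
Variable R : comNzRingType.

(** Simultaneous permutation of the rows and columns is conjugation by a
    permutation matrix; the two signs of the determinant cancel. *)
Lemma char_poly_perm n (s : 'S_n) (A : 'M[R]_n) :
  char_poly (\matrix_(i, j) A (s i) (s j)) = char_poly A.
Proof.
have -> : char_poly (\matrix_(i, j) A (s i) (s j))
          = \det (row_perm s (col_perm s (char_poly_mx A))).
  congr (\det _); apply/matrixP=> i j.
  by rewrite !mxE (inj_eq perm_inj).
rewrite row_permE col_permE !det_mulmx !det_perm odd_permV mulrCA -expr2.
by rewrite sqrr_sign mulr1.
Qed.

(** Indexing by a list rather than by the canonical enumeration of a set gives
    control over the order of the indices. Striking out the first row and column
    of [relmx f (a :: s)] leaves [relmx f s], with no cast between dimensions. *)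
Definition relmx (I : eqType) (f : I -> I -> R) (s : seq I) : 'M[R]_(size s) :=
  \matrix_(i, j) f (tnth (in_tuple s) i) (tnth (in_tuple s) j).

(** The dimensions [n] and [m] are not the same expression in the uses of this
    lemma; their equality follows from the bijection between the indices. *)
Lemma char_poly_reindex (I : finType) (f : I -> I -> R) n m
    (h : 'I_n -> I) (k : 'I_m -> I) :
  injective h -> injective k -> codom h =i codom k ->
  char_poly (\matrix_(i, j) f (h i) (h j))
  = char_poly (\matrix_(i, j) f (k i) (k j)).
Proof.
move=> h_inj k_inj hk.
have nm : n = m.
  by have := eq_card hk; rewrite !card_codom // !card_ord.
case: m / nm k k_inj hk => k k_inj hk.
have kP i : h i \in codom k by rewrite -hk codom_f.
pose s i := iinv (kP i).
have ks i : k (s i) = h i by apply: f_iinv.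
have s_inj : injective s by move=> i j E; apply: h_inj; rewrite -!ks E.
rewrite -(char_poly_perm (perm s_inj) (\matrix_(i, j) f (k i) (k j))).
by congr char_poly; apply/matrixP=> i j; rewrite !mxE !permE !ks.
Qed.

Lemma char_poly_relmx (I : finType) (f : I -> I -> R) n (h : 'I_n -> I) s :
  injective h -> uniq s -> codom h =i s ->
  char_poly (\matrix_(i, j) f (h i) (h j)) = char_poly (relmx f s).
Proof.
move=> h_inj s_uniq hs; apply: char_poly_reindex => //.
  exact/tuple_uniqP.
by move=> x; rewrite hs codomE map_tnth_enum.
Qed.

Lemma eq_relmx (I : eqType) (f g : I -> I -> R) s :
  {in s &, f =2 g} -> relmx f s = relmx g s.
Proof. by move=> fg; apply/matrixP=> i j; rewrite !mxE fg ?mem_tnth. Qed.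

(** Characteristic polynomial form of [det_pendant]. The entries of [xI - A] at
    [(a, b)] and [(b, a)] are both [-1], so their product contributes the
    coefficient [-1] of the last term. *)
Lemma char_poly_pendant (I : eqType) (f : I -> I -> R) (a b : I) s :
    f a a = 0 -> f a b = 1 -> f b a = 1 ->
    {in s, forall x, f a x = 0 /\ f x a = 0} ->
  char_poly (relmx f [:: a, b & s])
  = 'X * char_poly (relmx f (b :: s)) - char_poly (relmx f s).
Proof.
move=> faa fab fba fs.
have fs_nth i : (i < size s)%N -> f a (nth a s i) = 0 /\ f (nth a s i) a = 0.
  by move=> i_s; apply/fs/mem_nth.
have relmx_tail c t :
    row' ord0 (col' ord0 (char_poly_mx (relmx f (c :: t))))
    = char_poly_mx (relmx f t).
  by apply/matrixP=> i j; rewrite !mxE (inj_eq lift_inj) !(tnth_nth a).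
rewrite /char_poly -(relmx_tail b s) -(relmx_tail a (b :: s)).
rewrite (@det_pendant _ _ (char_poly_mx (relmx f [:: a, b & s]))).
- rewrite !mxE !(tnth_nth a) /= faa fab fba polyC0 polyC1.
  by rewrite subr0 !sub0r mulrNN !mul1r.
- by move=> j; rewrite !mxE !(tnth_nth a) /= (fs_nth _ (ltn_ord j)).1
    polyC0 subr0.
- by move=> j; rewrite !mxE !(tnth_nth a) /= (fs_nth _ (ltn_ord j)).2
    polyC0 subr0.
Qed.

End CharPoly.

(** * Unified matrices *)

Section Unified.
Variable T : finType.
Implicit Types (H : hypergraph T) (S e : {set T}) (u v : T).

Definition adjacent H S S' : bool :=
  [exists e in edges H, two_partition e S S'].

Lemma adjacentP H S S' :
  reflect (exists2 e, e \in edges H & two_partition e S S') (adjacent H S S').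
Proof. exact: exists_inP. Qed.

Lemma two_partitionC e S S' : two_partition e S S' = two_partition e S' S.
Proof. by rewrite /two_partition andbCA disjoint_sym setUC. Qed.

Lemma adjacentC H S S' : adjacent H S S' = adjacent H S' S.
Proof. by apply: eq_existsb => e; rewrite two_partitionC. Qed.

Lemma index_setP H S :
  reflect ((exists S', adjacent H S S')
           \/ exists2 x, x \in vertices H & S = [set x])
          (S \in index_set H).
Proof.
rewrite !inE; apply: (iffP orP) => -[SH|/imsetP SH]; try by right.
- have /exists_inP[e eH /existsP[S' eS]] := SH.
  by left; exists S'; apply/adjacentP; exists e.
- have [S' /adjacentP[e eH eS]] := SH.
  by left; apply/exists_inP; exists e => //; apply/existsP; exists S'.
Qed.

Lemma two_partition_sub e S S' : two_partition e S S' -> S \subset e.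
Proof. by case/and4P=> _ _ _ /eqP <-; apply: subsetUl. Qed.

Lemma two_partition_set2_mem u v S S' :
  two_partition [set u; v] S S' -> u \in S -> S = [set u] /\ S' = [set v].
Proof.
case/and4P=> _ /set0Pn[y yS'] SS' /eqP E uS.
have inS x : (x \in S) || (x \in S') = (x == u) || (x == v).
  by rewrite -in_setU E !inE.
have notS x : x \in S' -> (x \in S) = false.
  by rewrite disjoint_sym in SS' => /(disjointFr SS').
have vS' : v \in S'.
  have := inS y; rewrite yS' orbT => /esym/orP[]/eqP yE; last by rewrite -yE.
  by have := notS y yS'; rewrite yE uS.
split; apply/setP=> x; rewrite inE; apply/idP/eqP => [xS|->//].
  have := inS x; rewrite xS => /esym/orP[]/eqP // xv.
  by rewrite xv notS in xS.
have := inS x; rewrite xS orbT => /esym/orP[]/eqP // xu.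
by have := notS x xS; rewrite xu uS.
Qed.

(** Pairs are the only edges that the theorem adds or deletes: the new edge
    through [v], and the edges through [u] when [u] is a g-vertex. *)
Lemma two_partition_set2 u v S S' : u != v ->
  two_partition [set u; v] S S'
  = (S == [set u]) && (S' == [set v]) || (S == [set v]) && (S' == [set u]).
Proof.
move=> uv; apply/idP/orP => [eS|]; last first.
  have set1N0 x : [set x] != set0 :> {set T}.
    by apply/set0Pn; exists x; rewrite set11.
  by case=> /andP[/eqP-> /eqP->]; rewrite /two_partition !set1N0 disjoints1 inE
    1?[[set v] :|: _]setUC 1?[v == u]eq_sym uv eqxx.
have : u \in S :|: S' by case/and4P: eS => _ _ _ /eqP->; rewrite set21.
case/setUP=> [uS|uS'].
  by have [-> ->] := two_partition_set2_mem eS uS; left; rewrite !eqxx.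
rewrite two_partitionC in eS.
by have [-> ->] := two_partition_set2_mem eS uS'; right; rewrite !eqxx.
Qed.

Lemma index_set_sub H S : is_hypergraph H ->
  S \in index_set H -> S \subset vertices H.
Proof.
move=> [_ EH] /index_setP[[S' /adjacentP[e /EH[_ eH] /two_partition_sub Se]]|].
  exact: subset_trans eH.
by case=> x xH ->; rewrite sub1set.
Qed.

Lemma adjacent_sub H S S' : is_hypergraph H ->
  adjacent H S S' -> S \subset vertices H.
Proof.
by move=> HH HS; apply: (index_set_sub HH); apply/index_setP; left; exists S'.
Qed.

Lemma char_poly_unified_matrix (R : comNzRingType) H s :
  uniq s -> s =i index_set H ->
  char_poly (unified_matrix R H)
  = char_poly (relmx (fun S S' => (adjacent H S S')%:R : R) s).
Proof.
move=> s_uniq sH.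
rewrite -(@char_poly_relmx _ _ _ _ (@enum_val _ (index_set H))) //.
  exact: enum_val_inj.
move=> S; rewrite sH; apply/codomP/idP => [[i ->]|SH]; first exact: enum_valP.
by exists (enum_rank_in SH S); rewrite enum_rankK_in.
Qed.

(** Striking out the row and column of [{u}] restricts the matrix to the other
    indices, whatever position [{u}] has in the enumeration. *)
Lemma char_poly_delete_singleton (R : comNzRingType) H u
    (uH : u \in vertices H) s :
  uniq s -> s =i index_set H :\ [set u] ->
  char_poly (delete_row_col (unified_matrix R H) (singleton_index uH))
  = char_poly (relmx (fun S S' => (adjacent H S S')%:R : R) s).
Proof.
move=> s_uniq sH; set i0 := singleton_index uH.
have i0E : enum_val i0 = [set u].
  by rewrite enum_rankK_in // singleton_in_index_set.
rewrite -(@char_poly_relmx _ _ _ _ (fun i => enum_val (lift i0 i))) //.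
- by congr char_poly; apply/matrixP=> i j; rewrite !mxE.
- by move=> i j /enum_val_inj/lift_inj.
move=> S; rewrite sH in_setD1; apply/codomP/andP => [[i ->]|[Su SH]].
  split; last exact: enum_valP.
  by rewrite -i0E (inj_eq enum_val_inj) eq_sym neq_lift.
have : enum_rank_in SH S != i0.
  by apply: contraNneq Su => Si0; rewrite -i0E -Si0 enum_rankK_in.
rewrite eq_sym => /unlift_some[j Sj _]; exists j.
by rewrite -Sj enum_rankK_in.
Qed.

Lemma adjacent_add_pendant H u v S S' :
  adjacent (add_pendant H u v) S S'
  = two_partition [set u; v] S S' || adjacent H S S'.
Proof.
apply/adjacentP/orP => [[e]|[eS|/adjacentP[e eH eS]]].
- rewrite in_mset1D => /orP[/eqP->|eH] eS; first by left.
  by right; apply/adjacentP; exists e.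
- by exists [set u; v]; rewrite // in_mset1D eqxx.
- by exists e; rewrite // in_mset1D eH orbT.
Qed.

Lemma in_delete_vertex H u e :
  (e \in edges (delete_vertex H u)) = (u \notin e) && (e \in edges H).
Proof.
rewrite in_mset fsfunE msuppE -mset_gt0.
by case: (u \in e); case: (edges H e).
Qed.

(** No edge of [H] contains [v], so [{u, v}] is the only edge that has [{v}] as
    a part. *)
Lemma adjacent_pendant H u v S : is_hypergraph H ->
  u \in vertices H -> v \notin vertices H ->
  adjacent (add_pendant H u v) [set v] S = (S == [set u]).
Proof.
move=> HH uH vH; rewrite adjacent_add_pendant.
have uv : u != v by apply: contraNneq vH => <-.
have -> : adjacent H [set v] S = false.
  by apply: contraNF vH => /(adjacent_sub HH); rewrite sub1set.
rewrite orbF two_partition_set2 // eqxx /= (inj_eq set1_inj) eq_sym.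
by rewrite (negPf uv).
Qed.

(** The new edge creates no index besides [{v}], since its other part [{u}] is
    already a singleton of [H]. *)
Lemma index_set_add_pendant H u v :
  u \in vertices H -> v \notin vertices H ->
  index_set (add_pendant H u v) = [set v] |: index_set H.
Proof.
move=> uH vH; have uv : u != v by apply: contraNneq vH => <-.
apply/setP=> S; rewrite in_setU1; apply/index_setP/predU1P.
- case=> [[S']|[x /setU1P[->|xH] ->]]; last 2 first.
  + by left.
  + by right; apply: singleton_in_index_set.
  rewrite adjacent_add_pendant two_partition_set2 // => /orP[|HS].
    case/orP=> /andP[/eqP-> _]; last by left.
    by right; apply: singleton_in_index_set.
  by right; apply/index_setP; left; exists S'.
- case=> [->|/index_setP[[S' HS]|[x xH ->]]].
  + by right; exists v; rewrite ?setU11.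
  + by left; exists S'; rewrite adjacent_add_pendant HS orbT.
  + by right; exists x; rewrite ?setU1r.
Qed.

Lemma g_vertex_edge H u e : simple_hypergraph H -> is_g_vertex H u ->
  e \in edges H -> u \in e -> exists2 w, u != w & e = [set u; w].
Proof.
move=> [[_ EH] loopless _] [_ gu] eH ue.
have /cards2P[x [y [xy E]]] : #|e| == 2%N.
  rewrite eqn_leq leqNgt (contraL (gu e eH)) //=.
  by rewrite ltn_neqAle eq_sym loopless //= card_gt0 (EH e eH).1.
move: ue; rewrite E => /set2P[->|->]; first by exists y.
by exists x; rewrite 1?eq_sym 1?setUC.
Qed.

(** An edge through [u] is a pair and has [{u}] as one of its two parts, so it
    only produces entries in the row or the column of [{u}]. *)
Lemma adjacent_delete_vertex H u S S' :
  simple_hypergraph H -> is_g_vertex H u ->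
  adjacent (delete_vertex H u) S S'
  = [&& S != [set u], S' != [set u] & adjacent H S S'].
Proof.
move=> simpleH gu; apply/adjacentP/and3P => [[e]|[Su S'u]].
- rewrite in_delete_vertex => /andP[ue eH] eS.
  have S_neq S1 S2 : two_partition e S1 S2 -> S1 != [set u].
    by move/two_partition_sub; apply: contraTneq => ->; rewrite sub1set.
  split; [exact: S_neq eS | by apply: (S_neq _ S); rewrite two_partitionC |].
  by apply/adjacentP; exists e.
- move=> /adjacentP[e eH eS]; exists e => //; rewrite in_delete_vertex eH andbT.
  apply/negP => /(g_vertex_edge simpleH gu eH)[w uw E].
  move: eS; rewrite E two_partition_set2 //.
  by rewrite (negPf Su) (negPf S'u) andbF.
Qed.

(** A part [S] of an edge of [H] may be lost with the edge when [u] is deleted: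
    this happens when its complement is [{u}]. The edge is then a pair, so that
    [S] is a singleton and remains an index for that reason. *)
Lemma index_set_delete_vertex H u :
  simple_hypergraph H -> is_g_vertex H u ->
  index_set (delete_vertex H u) = index_set H :\ [set u].
Proof.
move=> simpleH gu; have [HH _ _] := simpleH.
apply/setP=> S; rewrite in_setD1; apply/index_setP/andP.
- case=> [[S']|[x /setD1P[xu xH] ->]].
    rewrite adjacent_delete_vertex // => /and3P[Su _ HS].
    by split=> //; apply/index_setP; left; exists S'.
  by rewrite (inj_eq set1_inj) xu singleton_in_index_set.
- case=> Su SH; have [[S' HS]|[x xH Sx]] := index_setP _ _ SH; last first.
    right; exists x => //; apply/setD1P; split=> //.
    by apply: contraNneq Su => <-; rewrite Sx.
  have [S'u|S'u] := eqVneq S' [set u]; last first.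
    by left; exists S'; rewrite adjacent_delete_vertex // Su S'u.
  have [e eH eS] := adjacentP _ _ _ HS.
  have ue : u \in e.
    rewrite two_partitionC S'u in eS.
    by have := two_partition_sub eS; rewrite sub1set.
  have [w uw E] := g_vertex_edge simpleH gu eH ue.
  move: eS; rewrite E two_partition_set2 // (negPf Su) /=.
  case/andP=> /eqP-> _; right; exists w => //.
  rewrite !inE eq_sym uw; apply: (subsetP (HH.2 e eH).2).
  by rewrite E set22.
Qed.

End Unified.

Theorem theorem8p1 (R : comNzRingType) (T : finType) (H : hypergraph T)
    (u v : T) (simpleH : simple_hypergraph H)
    (uH : u \in vertices H) (vH : v \notin vertices H) :
  char_poly (unified_matrix R (add_pendant H u v)) =
    'X * char_poly (unified_matrix R H)
    - char_poly (delete_row_col (unified_matrix R H) (singleton_index uH))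
  /\
  (is_g_vertex H u ->
   char_poly (unified_matrix R (add_pendant H u v)) =
     'X * char_poly (unified_matrix R H)
     - char_poly (unified_matrix R (delete_vertex H u))).
Proof.
have [HH _ _] := simpleH.
set s := enum (index_set H :\ [set u]).
have s_uniq : uniq s by apply: enum_uniq.
have sE : s =i index_set H :\ [set u] by move=> S; rewrite mem_enum.
have us_uniq : uniq ([set u] :: s) by rewrite /= sE setD11.
have usE : [set u] :: s =i index_set H.
  by move=> S; rewrite inE sE -in_setU1 setD1K ?singleton_in_index_set.
have main : char_poly (unified_matrix R (add_pendant H u v)) =
    'X * char_poly (unified_matrix R H)
    - char_poly (delete_row_col (unified_matrix R H) (singleton_index uH)).
  have vI : [set v] \notin index_set H.
    by apply: contra vH => /(index_set_sub HH); rewrite sub1set.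
  (* The indices are listed with [{v}] and [{u}] first, so that the three
     matrices are those of a list and of its two successive tails. *)
  rewrite (char_poly_delete_singleton _ uH s_uniq sE).
  rewrite (char_poly_unified_matrix _ us_uniq usE).
  rewrite (@char_poly_unified_matrix _ _ _ [:: [set v], [set u] & s]); first last.
  - by move=> S; rewrite in_cons usE index_set_add_pendant // in_setU1.
  - by rewrite cons_uniq us_uniq usE vI.
  have pendant S : adjacent (add_pendant H u v) [set v] S = (S == [set u]).
    exact: adjacent_pendant.
  have uv : u != v by apply: contraNneq vH => <-.
  rewrite char_poly_pendant.
  - have adjH : {in index_set H &, forall S S',
        adjacent (add_pendant H u v) S S' = adjacent H S S'}.
      have neqv S : S \in index_set H -> (S == [set v]) = false.
        by move=> SH; apply: contraNF vI => /eqP<-.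
      move=> S S' SH S'H; rewrite adjacent_add_pendant two_partition_set2 //.
      by rewrite !neqv // andbF.
    rewrite !(@eq_relmx _ _ _ (fun S S' => (adjacent H S S')%:R)) //;
      move=> S S' Ss S's.
      by rewrite adjH // -usE in_cons ?Ss ?S's orbT.
    by rewrite adjH // -usE.
  - by rewrite pendant (inj_eq set1_inj) eq_sym (negPf uv).
  - by rewrite pendant eqxx.
  - by rewrite adjacentC pendant eqxx.
  - move=> S; rewrite sE => /setD1P[Su _].
    by rewrite [adjacent _ S _]adjacentC pendant (negPf Su).
split=> // gu; rewrite main; congr (_ - _).
rewrite (char_poly_delete_singleton _ uH s_uniq sE).
rewrite (@char_poly_unified_matrix _ _ _ s) ?index_set_delete_vertex //.
congr char_poly; apply: eq_relmx => S S'; rewrite !sE.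
move=> /setD1P[Su _] /setD1P[S'u _].
by rewrite adjacent_delete_vertex // Su S'u.
Qed.
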